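(* Let $N_0,M_0\in\mathbb{N}$ and let $\mathcal{T}$ be a random variable with support in $[a,b]$, where $a\ge 0$, and with mean $\mu>0$. Any algorithm $A$ for the Permutation Flowshop Scheduling Problem satisfies $$\lim_{N\to\infty}\mathbb{P}\left(\alpha_A\bigl(\mathcal{I}(N,M_0,\mathcal{T})\bigr)\le\frac{b}{\mu}\right)=1,$$ $$\lim_{M\to\infty}\mathbb{P}\left(\alpha_A\bigl(\mathcal{I}(N_0,M,\mathcal{T})\bigr)\le\frac{b}{\mu}\right)=1.$$
   Context: Permutation Flowshop Scheduling Problem (PFSP): an instance consists of $N\ge 1$ jobs, $M\ge 1$ machines, and a matrix of constant non-negative processing times $t_{i,j}$ ($1\le i\le M$, $1\le j\le N$), where $t_{i,j}$ is the processing time of job $j$ on machine $i$. A schedule is a permutation $\pi=(\pi_1,\dots,\pi_N)$ of the jobs. For a given $\pi$ the completion times $C_{i,j}$ are defined by $C_{1,\pi_1}=t_{1,\pi_1}$; $C_{i,\pi_1}=t_{i,\pi_1}+C_{i-1,\pi_1}$ for $1<i\le M$; $C_{1,\pi_j}=t_{1,\pi_j}+C_{1,\pi_{j-1}}$ for $1<j\le N$; and $C_{i,\pi_j}=t_{i,\pi_j}+\max\{C_{i-1,\pi_j},C_{i,\pi_{j-1}}\}$ otherwise. The makespan is $C_{max}(\pi)=C_{M,\pi_N}$, and $OPT(I)=\min_\pi C_{max}(\pi)$ is the minimum makespan of the instance $I$. An algorithm $A$ assigns to each instance $I$ a permutation of its jobs; $A(I)$ denotes the makespan of that permutation, and the approximation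 ratio of $A$ on $I$ is $\alpha_A(I)=\frac{A(I)}{OPT(I)}$. For $N,M\in\mathbb{N}$ (positive integers) and a random variable $\mathcal{T}$, $\mathcal{I}(N,M,\mathcal{T})$ denotes the random instance with $N$ jobs and $M$ machines whose processing times $T_{i,j}$ are independent and identically distributed with the same distribution as $\mathcal{T}$. *)

(* Defs.v *)
From HB Require Import structures.
From mathcomp Require Import all_boot all_order all_algebra perm.
From mathcomp Require Import all_classical all_reals all_analysis.

Set Implicit Arguments.
Unset Strict Implicit.
Unset Printing Implicit Defensive.

Import Order.TTheory GRing.Theory Num.Theory.

Local Open Scope classical_set_scope.
Local Open Scope ring_scope.

(** Permutation flowshop.  An instance with [M.+1] machines and [N.+1] jobs is
    its matrix of processing times, rows being machines and columns jobs; the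
    successors encode that both counts are positive.  A schedule is a
    permutation [s : 'S_N.+1] sending each position to the job scheduled there. *)

Section Flowshop.
Variable R : realType.

(** With [t i j] the processing time on machine [i] of the job in position [j]
    (both counted from 0), [completion t i j] is the completion time on machine
    [i] of the job in position [j]. *)
Fixpoint completion (t : nat -> nat -> R) (i : nat) : nat -> R :=
  match i with
  | 0%N =>
      fix row (j : nat) : R :=
        match j with
        | 0%N => t 0%N 0%N
        | j'.+1 => t 0%N j + row j'
        end
  | i'.+1 =>
      fix row (j : nat) : R :=
        match j with
        | 0%N => t i 0%N + completion t i' 0%N
        | j'.+1 => t i j + Num.max (completion t i' j) (row j')
        end
  end.

Definition makespan (M N : nat) (t : 'M[R]_(M.+1, N.+1)) (s : 'S_N.+1) : R :=
  completion (fun i j => t (inord i) (s (inord j))) M N.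

Definition opt (M N : nat) (t : 'M[R]_(M.+1, N.+1)) : R :=
  \big[Num.min/makespan t 1%g]_(s : 'S_N.+1) makespan t s.

(** Only the values on matrices with nonnegative entries are meaningful; any
    assignment defined on those alone extends to all matrices. *)
Definition algorithm : Type :=
  forall M N : nat, 'M[R]_(M.+1, N.+1) -> 'S_N.+1.

(** Division by zero returns 0, so the ratio is 0 when [opt t = 0]. *)
Definition approx_ratio (A : algorithm) (M N : nat) (t : 'M[R]_(M.+1, N.+1)) : R :=
  makespan t (A M N t) / opt t.

End Flowshop.

Section Probability.
Context {R : realType}.

Definition mutually_independent d (Omega : measurableType d)
    (P : probability Omega R) (I : finType) (X : I -> {RV P >-> R}) : Prop :=
  forall (J : {set I}) (B : I -> set R), (forall i, measurable (B i)) ->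
    P [set w | forall i, i \in J -> B i (X i w)] =
    (\prod_(i in J) P (X i @^-1` B i))%E.

(** The law of [X] and [Y] is compared on Borel sets only, the values of a
    measure on other sets being unspecified. *)
Definition same_distribution d d' (Omega : measurableType d)
    (Omega' : measurableType d') (P : probability Omega R)
    (P' : probability Omega' R) (X : {RV P >-> R}) (Y : {RV P' >-> R}) : Prop :=
  forall B : set R, measurable B -> distribution P X B = distribution P' Y B.

(** Inner probability.  An algorithm is an arbitrary function, so an event
    depending on its output need not be measurable; on measurable events this
    is [P] (see [inner_probE]). *)
Definition inner_prob d (Omega : measurableType d) (P : probability Omega R)
    (E : set Omega) : \bar R :=
  ereal_sup [set P F | F in [set F | measurable F /\ F `<=` E]].

Lemma inner_probE d (Omega : measurableType d) (P : probability Omega R)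
    (E : set Omega) : measurable E -> inner_prob P E = P E.
Proof.
move=> mE; apply/eqP; rewrite eq_le; apply/andP; split.
  apply: ge_ereal_sup => _ [F [mF FE] <-].
  by apply: le_measure => //; rewrite inE.
by apply: ereal_sup_ubound; exists E => //; split.
Qed.

(** A realization of the random instance with [M.+1] machines and [N.+1] jobs,
    on some probability space. *)
Record random_instance d (Omega : measurableType d) (P : probability Omega R)
    (T : {RV P >-> R}) (M N : nat) := RandomInstance {
  ri_display : measure_display;
  ri_space : measurableType ri_display;
  ri_prob : probability ri_space R;
  ri_time : 'I_M.+1 * 'I_N.+1 -> {RV ri_prob >-> R};
  ri_indep : mutually_independent ri_time;
  ri_ident : forall ij, same_distribution (ri_time ij) T
}.

Definition ri_matrix d (Omega : measurableType d) (P : probability Omega R)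
    (T : {RV P >-> R}) (M N : nat) (I : random_instance T M N)
    (w : ri_space I) : 'M[R]_(M.+1, N.+1) :=
  \matrix_(i, j) ri_time I (i, j) w.

Definition prob_ratio_le d (Omega : measurableType d) (P : probability Omega R)
    (T : {RV P >-> R}) (A : algorithm R) (M N : nat) (I : random_instance T M N)
    (c : R) : \bar R :=
  inner_prob (ri_prob I) [set w | approx_ratio A (ri_matrix w) <= c].

End Probability.

(* Main.v *)
Require Import Defs.
From HB Require Import structures.
From mathcomp Require Import all_boot all_order all_algebra perm.
From mathcomp Require Import all_classical all_reals all_analysis measurable_realfun.
From mathcomp Require Import ring lra.

(** The makespan of a schedule is the length of its critical path, a staircase
    from the first machine and position to the last ones, which visits every
    column and every row of the matrix of processing times.  Call lines the columns when the number of
    jobs grows, and the rows when the number of machines grows; say that there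
    are [n] lines of [K + 1] cells each.

    - Upper bound, for every schedule: the path spends one cell on each line,
      and each of the [K] remaining cells costs at most [b].  Hence the makespan
      is at most the sum over the lines of their largest entry, plus [K * b]
      ([makespan_le_cols], [makespan_le_rows]).
    - Lower bound, for every schedule: the makespan is at least the load of one
      machine, and at least the total length of one job ([opt_ge_row],
      [opt_ge_col]).  Either is a sum of one entry per line, which by the weak
      law of large numbers is about [n * mu] ([sum_whp]).

    If [T <= c] has positive probability for some [c < b], then with a
    probability [p > 0] all the entries of a line are at most [c], so that a
    proportion [p] of the lines has a maximum at most [c].  The makespan of the
    worst schedule is then at most about [n * (b - (b - c) * p)], and dividing by
    [n * mu] leaves a ratio strictly below [b / mu], with a margin that absorbs
    [K * b] and the fluctuations.  Otherwise [T = b] almost surely, all the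
    schedules have the same makespan, and the ratio is at most 1, hence at most
    [b / mu].  Both cases are in [ratio_whp].

    The only law of large numbers needed is Chebyshev's inequality for the number
    of occurrences among pairwise independent events of equal probability
    ([count_deviation]).  The sum of the entries is bounded below through the
    counts of the events [k * e <= T], for the levels [k * e] of a fine
    subdivision of [[0, b]]: the number of levels below [x], times [e],
    approximates [x] to within [e] ([level_sum_le], [level_sum_ge]).  In this way
    the product rule for events is used directly, without computing
    expectations of products of random variables. *)

Set Implicit Arguments.
Unset Strict Implicit.
Unset Printing Implicit Defensive.

Import Order.TTheory GRing.Theory Num.Theory.
Import numFieldNormedType.Exports.

Local Open Scope classical_set_scope.
Local Open Scope ring_scope.

(** * Deterministic bounds on the makespan *)

Section Completion.
Variable R : realType.
Implicit Types t : nat -> nat -> R.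

(** The recurrence is symmetric in machines and positions; this turns each bound
    by columns into the bound by rows. *)
Lemma completion_tr t i j :
  completion (fun x y => t y x) j i = completion t i j.
Proof.
elim: i j => [|i IHi]; elim=> [|j IHj] //=.
- by congr (_ + _); exact: IHj.
- by congr (_ + _); exact: (IHi 0%N).
- by rewrite maxC; congr (_ + Num.max _ _); [exact: (IHi j.+1) | exact: IHj].
Qed.

(** A step of the critical path to the next position pays the bound [m] of that
    column, and each of the [i] steps to the next machine pays at most [b]. *)
Lemma completion_le_lines t (m : nat -> R) b i j :
  (forall i j, t i j <= m j) -> (forall i j, t i j <= b) ->
  completion t i j <= \sum_(k < j.+1) m k + b *+ i.
Proof.
move=> tm tb; elim: i j => [|i IHi]; elim=> [|j IHj].
- by rewrite /= big_ord1 addr0.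
- by rewrite /= big_ord_recr [leLHS]addrC [leRHS]addrAC lerD.
- by rewrite /= mulrS addrCA lerD.
- rewrite /= addr_maxr ge_max; apply/andP; split.
    by rewrite mulrS addrCA lerD.
  by rewrite big_ord_recr [leLHS]addrC [leRHS]addrAC lerD.
Qed.

Lemma completion_ge0 t i j :
  (forall i j, 0 <= t i j) -> 0 <= completion t i j.
Proof.
move=> t0; elim: i j => [|i IHi]; elim=> [|j IHj] //=; apply: addr_ge0 => //.
by rewrite le_max IHi.
Qed.

(** The operations of one job are done one after the other, so the column of that
    job is a lower bound from its own position on. *)
Lemma completion_ge_line t i j p :
  (forall i j, 0 <= t i j) -> (p <= j)%N ->
  \sum_(k < i.+1) t k p <= completion t i j.
Proof.
move=> t0 /subnK <-; elim: (j - p)%N => [|n IH].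
  elim: i => [|i IHi].
    rewrite big_ord1; case: p => //= p.
    by rewrite lerDl (completion_ge0 0).
  rewrite big_ord_recr /= addrC.
  by case: p IHi => [|p] IHi /=; rewrite lerD // ?le_max ?IHi.
apply: (le_trans IH); rewrite addSn; case: i {IH} => [|i] /=.
  by rewrite lerDr.
by rewrite ler_wpDl // le_max lexx orbT.
Qed.

End Completion.

Section Makespan.
Variables (R : realType) (M N : nat).
Implicit Types (t : 'M[R]_(M.+1, N.+1)) (s : 'S_N.+1).

Lemma makespan_le_cols t s (m : 'I_N.+1 -> R) b :
  (forall i j, t i j <= m j) -> (forall i j, t i j <= b) ->
  makespan t s <= \sum_j m j + b *+ M.
Proof.
move=> tm tb; rewrite (reindex_inj (@perm_inj _ s)) /=.
have H := @completion_le_lines R (fun i j => t (inord i) (s (inord j)))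
  (fun j => m (s (inord j))) b M N (fun _ _ => tm _ _) (fun _ _ => tb _ _).
apply: (le_trans H); rewrite lerD2r.
by apply: ler_sum => k _ /=; rewrite inord_val.
Qed.

Lemma makespan_le_rows t s (m : 'I_M.+1 -> R) b :
  (forall i j, t i j <= m i) -> (forall i j, t i j <= b) ->
  makespan t s <= \sum_i m i + b *+ N.
Proof.
move=> tm tb; rewrite /makespan -completion_tr.
have H := @completion_le_lines R (fun j i => t (inord i) (s (inord j)))
  (fun i => m (inord i)) b N M (fun _ _ => tm _ _) (fun _ _ => tb _ _).
apply: (le_trans H); rewrite lerD2r.
by apply: ler_sum => k _ /=; rewrite inord_val.
Qed.

Lemma opt_ge t x : (forall s, x <= makespan t s) -> x <= opt t.
Proof. by move=> H; apply: le_bigmin. Qed.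

(** The load of a machine does not depend on the order of the jobs, which is why
    the bound passes to the optimum. *)
Lemma opt_ge_row t i : (forall i j, 0 <= t i j) -> \sum_j t i j <= opt t.
Proof.
move=> t0; apply: opt_ge => s; rewrite /makespan -completion_tr.
rewrite (reindex_inj (@perm_inj _ s)) /=.
have := @completion_ge_line R (fun j i => t (inord i) (s (inord j)))
  N M i (fun _ _ => t0 _ _).
rewrite -ltnS => /(_ (ltn_ord i)); apply: le_trans.
by under [leRHS]eq_bigr do rewrite !inord_val.
Qed.

(** The position of job [j] depends on the schedule [s], but its total length
    does not. *)
Lemma opt_ge_col t j : (forall i j, 0 <= t i j) -> \sum_i t i j <= opt t.
Proof.
move=> t0; apply: opt_ge => s; rewrite /makespan.
have := @completion_ge_line R (fun i j => t (inord i) (s (inord j)))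
  M N (s^-1%g j) (fun _ _ => t0 _ _).
rewrite -ltnS => /(_ (ltn_ord _)); apply: le_trans.
by under [leRHS]eq_bigr do rewrite !inord_val permKV.
Qed.

Lemma makespan_const t s x : (forall i j, t i j = x) -> makespan t s = opt t.
Proof.
move=> tx; have E s' : makespan t s' = makespan t s.
  by rewrite /makespan; congr completion; do 2 apply: funext => ?; rewrite !tx.
apply/eqP; rewrite eq_le opt_ge ?E // => [|s']; last by rewrite E.
by rewrite /opt (bigD1 s) //= ge_min lexx.
Qed.

End Makespan.

(** * Events whose probability tends to one *)

Section Whp.
Variable R : realType.
Variables (disp : nat -> measure_display) (W : forall n, measurableType (disp n)).
Variable Q : forall n, probability (W n) R.

(** With high probability.  Asking for a measurable subset of [E n] of
    probability at least [1 - e], rather than for a bound on the measure of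
    [E n], lets [E n] be non-measurable, as events that involve the output of
    an algorithm may be. *)
Definition whp (E : forall n, set (W n)) : Prop :=
  forall e : R, 0 < e -> \forall n \near \oo,
    exists F : set (W n),
      [/\ measurable F, F `<=` E n & (Q n (~` F) <= e%:E)%E].

Lemma whp_sub (E F : forall n, set (W n)) :
  (\forall n \near \oo, E n `<=` F n) -> whp E -> whp F.
Proof.
move=> EF wE e e0; near=> n.
have [G [mG GE QG]] : exists G : set (W n),
  [/\ measurable G, G `<=` E n & (Q n (~` G) <= e%:E)%E].
  by near: n; exact: wE.
exists G; split => //; apply: (subset_trans GE).
by near: n.
Unshelve. all: by end_near. Qed.

Lemma whpI (E F : forall n, set (W n)) :
  whp E -> whp F -> whp (fun n => E n `&` F n).
Proof.
move=> wE wF e e0; have e20 : 0 < e / 2 by rewrite divr_gt0.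
have := wF _ e20; have := wE _ e20; apply: filterS2 => n.
move=> [G [mG GE QG]] [H [mH HE QH]]; exists (G `&` H); split.
- exact: measurableI.
- exact: setISS.
rewrite setCI (le_trans (measureU2 _ _ _)) //; try exact: measurableC.
by rewrite (splitr e) EFinD leeD.
Qed.

Lemma whp_bigI (K : nat) (E : nat -> forall n, set (W n)) :
  (forall k, whp (E k)) -> whp (fun n => [set w | forall k, (k < K)%N -> E k n w]).
Proof.
move=> wE; elim: K => [|K IH].
  move=> e e0; apply: nearW => n; exists setT; split => //.
  by rewrite setCT measure0 lee_fin ltW.
apply: whp_sub (whpI (wE K) IH); apply: nearW => n w [H1 H2] k.
by rewrite ltnS leq_eqVlt => /predU1P[->//|]; exact: H2.
Qed.

Lemma whp_cvg (E : forall n, set (W n)) :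
  whp E -> inner_prob (Q n) (E n) @[n --> \oo] --> 1%E.
Proof.
move=> wE.
have Ele1 n : (inner_prob (Q n) (E n) <= 1)%E.
  by apply: ge_ereal_sup => _ [F [mF FE] <-]; exact: probability_le1.
have Ege0 n : (0 <= inner_prob (Q n) (E n))%E.
  by apply: ereal_sup_ubound; exists set0; rewrite ?measure0//; split.
have Efin n : inner_prob (Q n) (E n) \is a fin_num.
  by rewrite ge0_fin_numE // (le_lt_trans (Ele1 n)) ?ltry.
apply/fine_cvgP; split; first by apply: nearW.
apply/cvgrPdist_le => /= e e0; have := wE _ e0; apply: filterS => n.
move=> [F [mF FE QF]]; have l1 := Ele1 n.
have QFl : (Q n F <= inner_prob (Q n) (E n))%E.
  by apply: ereal_sup_ubound; exists F.
have := QF; rewrite probability_setC // => QF'.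
rewrite -(fineK (Efin n)) lee_fin in l1.
rewrite -(fineK (Efin n)) -(@fineK _ (Q n F)) ?fin_num_measure // lee_fin in QFl.
rewrite -(@fineK _ (Q n F)) ?fin_num_measure // -EFinB lee_fin in QF'.
rewrite ger0_norm; lra.
Qed.

End Whp.

(** * Chebyshev's inequality for pairwise independent events *)

Section Counting.
Context d (W : measurableType d) (R : realType) (Q : probability W R).

Lemma measurable_le_const (f : W -> R) c :
  measurable_fun setT f -> measurable [set w | c <= f w].
Proof.
move=> mf; rewrite (_ : [set w | c <= f w] = setT `&` f @^-1` [set` `[c, +oo[]).
  by apply: mf => //; exact: measurable_itv.
by rewrite setTI; apply/seteqP; split=> w /=; rewrite in_itv /= andbT.
Qed.

Lemma measurable_lt_const (f : W -> R) c :
  measurable_fun setT f -> measurable [set w | f w < c].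
Proof.
move=> mf; rewrite (_ : [set w | f w < c] = ~` [set w | c <= f w]).
  by apply: measurableC; exact: measurable_le_const.
by apply/seteqP; split=> w /=; rewrite ltNge => /negP.
Qed.

Lemma covariance_indic (A B : set W) : measurable A -> measurable B ->
  covariance Q \1_A \1_B = (Q (A `&` B) - Q A * Q B)%E.
Proof.
move=> mA mB; have L C : measurable C -> (\1_C : W -> R) \in Lfun Q 1.
  by move=> mC; apply/Lfun1_integrable; exact: integrable_indic.
have AB : \1_A * \1_B = \1_(A `&` B) :> (W -> R) by rewrite indicI.
have mAB := measurableI _ _ mA mB.
by rewrite covarianceE ?AB ?L // !expectation_indic.
Qed.

(** Pairwise independence makes the variance of the count the sum of the [n + 1]
    variances [q - q ^+ 2], each at most 1; Markov's inequality for the square of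
    the centered count then gives a bound in [1 / (n + 1)]. *)
Lemma count_deviation n (E : 'I_n.+1 -> set W) (q e : R) :
  0 < e -> (forall l, measurable (E l)) -> (forall l, Q (E l) = q%:E) ->
  (forall l l', l != l' -> Q (E l `&` E l') = (q ^+ 2)%:E) ->
  (Q [set w | (\sum_l (\1_(E l) w : R) < n.+1%:R * (q - e))%R]
    <= (e ^- 2 / n.+1%:R)%:E)%E.
Proof.
move=> e0 mE QE QEE.
pose Z (w : W) : R := \sum_l (\1_(E l) w - q).
have mI l : measurable_fun setT (fun w => \1_(E l) w - q : R).
  by apply: measurable_funB => //; exact: measurable_cst.
have mZ : measurable_fun setT Z by apply: measurable_sum.
have q0 : 0 <= q by rewrite -lee_fin -(QE ord0).
have intI l l' : Q.-integrable setT
    (fun w => ((\1_(E l) w - q) * (\1_(E l') w - q))%:E).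
  apply: measurable_bounded_integrable => //.
  - by rewrite (le_lt_trans (probability_le1 Q measurableT)) ?ltry.
  - by apply: measurable_funM.
  exists ((1 + q) ^+ 2); split; first by rewrite num_real.
  move=> x xlt w _ /=; apply: ltW; apply: le_lt_trans xlt.
  rewrite normrM expr2 ler_pM // indicE;
  by rewrite (le_trans (ler_normB _ _)) // lerD // ger0_norm // lern1;
     case: (_ \in _).
(* In the double sum of covariances only the diagonal survives. *)
have EZ2 : ('E_Q[fun w => (Z w ^+ 2)%R])%E = (n.+1%:R * (q - q ^+ 2))%:E.
  rewrite unlock.
  transitivity (\int[Q]_w (\sum_(p <- index_enum ('I_n.+1 * 'I_n.+1)%type)
     ((\1_(E p.1) w - q) * (\1_(E p.2) w - q))%:E))%E.
    apply: eq_integral => w _; rewrite sumEFin expr2 /Z big_distrlr /=.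
    by rewrite pair_big.
  rewrite integral_sum //=.
  transitivity (\sum_(p : 'I_n.+1 * 'I_n.+1)
     (if p.1 == p.2 then (q - q ^+ 2) else 0)%:E)%E.
    apply: eq_bigr => -[l l'] _ /=.
    have := covariance_indic (mE l) (mE l').
    rewrite unlock !expectation_indic // !QE unlock /= => ->.
    case: eqVneq => [->|ll']; first by rewrite setIid QE.
    by rewrite QEE // -EFinD -expr2 subrr.
  rewrite sumEFin -(pair_bigA _ (fun l l' => if l == l' then _ else _)) /=.
  congr EFin; rewrite (eq_bigr (fun=> q - q ^+ 2)) => [|l _].
    by rewrite sumr_const card_ord mulr_natl.
  rewrite (bigD1 l) //= eqxx big1 ?addr0 // => l' /negPf.
  by rewrite eq_sym => ->.
have n0 : 0 < n.+1%:R :> R by rewrite ltr0n.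
pose ZM := HB.pack_for {RV Q >-> R} Z (isMeasurableFun.Build _ _ _ _ _ mZ).
have mk := @markov _ _ _ Q ZM (fun x => x ^+ 2) (n.+1%:R * e) (mulr_gt0 n0 e0).
have {mk} : (((n.+1%:R * e) ^+ 2)%:E * Q [set w | (n.+1%:R * e <= `|Z w|)%R]
    <= (n.+1%:R * (q - q ^+ 2))%:E)%E.
  rewrite -EZ2; apply: le_trans (mk _ _ _) _.
  - exact: measurable_funX.
  - by move=> r _; exact: sqr_ge0.
  - by move=> x y; rewrite !nnegrE => x0 y0; rewrite ler_sqr.
  - rewrite le_eqVlt; apply/orP; left; apply/eqP; congr expectation.
    by apply: funext => w /=; rewrite real_normK // num_real.
rewrite -lee_pdivlMl ?exprn_gt0 ?mulr_gt0 // -EFinM => dev.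
apply: (@le_trans _ _ (Q [set w | (n.+1%:R * e <= `|Z w|)%R])).
  apply: le_measure; rewrite ?inE.
  - apply: measurable_lt_const; apply: measurable_sum => l.
    exact: measurable_indic.
  - by apply: measurable_le_const; exact: measurableT_comp.
  - move=> w /= lt; rewrite ler_normr; apply/orP; right.
    rewrite /Z sumrB sumr_const card_ord -mulr_natl.
    by move: lt; rewrite mulrBr ltrBrDl -ltrBrDr => /ltW; rewrite opprB; lra.
apply: (le_trans dev); rewrite lee_fin exprMn.
have q1 : q - q ^+ 2 <= 1.
  have := probability_le1 Q (mE ord0); rewrite QE lee_fin => q1.
  by rewrite (le_trans _ q1) // gerBl sqr_ge0.
rewrite [leLHS](_ : _ = e ^- 2 / n.+1%:R * (q - q ^+ 2)).
  by rewrite ler_piMr // divr_ge0 ?invr_ge0 ?sqr_ge0 ?ler0n.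
by field; rewrite !gt_eqF.
Qed.

End Counting.

(** * Approximation of a random variable by level events *)

Section Levels.
Variable R : realType.

Lemma level_sum_le L (x e : R) : 0 <= x -> 0 <= e ->
  e * \sum_(k < L) ((k.+1%:R * e <= x)%R : nat)%:R <= x.
Proof.
move=> x0 e0; elim: L => [|L IH]; first by rewrite big_ord0 mulr0.
rewrite big_ord_recr /=; case: (leP (L.+1%:R * e) x) => [Lx|_]; last first.
  by rewrite /= addr0.
rewrite (le_trans _ Lx) // mulrC ler_wpM2r // -natr1 lerD2r.
rewrite -[in leRHS](card_ord L) -sumr_const; apply: ler_sum => k _.
by rewrite lern1; case: (_ <= _).
Qed.

(** The levels start at [k = 0] here and at [k = 1] in [level_sum_le]; the level 0,
    which contributes at most [e], is the whole error of the approximation. *)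
Lemma level_sum_ge L (x e : R) : 0 <= x -> 0 <= e -> x <= L.+1%:R * e ->
  x <= e * \sum_(k < L.+1) ((k%:R * e <= x)%R : nat)%:R.
Proof.
move=> x0 e0; elim: L => [|L IH] xle.
  by rewrite big_ord1 mul0r x0 mulr1 -[e]mul1r.
have [Lx|xL] := leP (L.+1%:R * e) x; last first.
  by rewrite big_ord_recr /= (lt_geF xL) /= addr0 IH // ltW.
rewrite (eq_bigr (fun=> 1)) => [|k _]; last first.
  by rewrite (le_trans _ Lx) // ler_wpM2r // ler_nat -ltnS.
by rewrite sumr_const card_ord mulrC.
Qed.

End Levels.

Section Law.
Context {R : realType} d {Omega : measurableType d} (P : probability Omega R).
Variable T : {RV P >-> R}.

Definition law (B : set R) : R := fine (P (T @^-1` B)).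

Lemma measurable_RV_preimage (B : set R) : measurable B -> measurable (T @^-1` B).
Proof.
by move=> mB; rewrite -[X in measurable X]setTI; exact: measurable_funP.
Qed.

Lemma lawE (B : set R) : measurable B -> P (T @^-1` B) = (law B)%:E.
Proof.
by move=> mB; rewrite fineK // fin_num_measure //; exact: measurable_RV_preimage.
Qed.

Lemma law_ge0 B : 0 <= law B. Proof. exact: fine_ge0. Qed.

Lemma law_le1 (B : set R) : measurable B -> law B <= 1.
Proof.
move=> mB; rewrite -lee_fin -lawE //.
by apply: probability_le1; exact: measurable_RV_preimage.
Qed.

(** Take expectations in [level_sum_ge], with [L + 1] levels of step
    [b / (L + 1)].  Comparing expectations takes nonnegative functions, and [T]
    is nonnegative only almost surely, which is why it is first replaced by its
    positive part. *)
Lemma mean_le_levels (a b mu : R) L :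
  0 <= a -> P (T @^-1` `[a, b]) = 1%E -> 'E_P[T]%E = mu%:E ->
  mu <= b / L.+1%:R * \sum_(k < L.+1) law `[k%:R * (b / L.+1%:R), +oo[.
Proof.
move=> a0 Tab ET; set e := b / L.+1%:R.
have ab : a <= b.
  rewrite leNgt; apply/negP => ba; move: Tab.
  rewrite (_ : T @^-1` _ = set0) ?measure0 => [/eqP|].
    by rewrite eq_sym onee_eq0.
  apply/seteqP; split=> w //=; rewrite in_itv /= => /andP[aT Tb].
  by move: (le_lt_trans (le_trans aT Tb) ba); rewrite ltxx.
have e0 : 0 <= e by rewrite divr_ge0 // (le_trans a0 ab).
have eE : L.+1%:R * e = b by rewrite /e mulrC divfK // pnatr_eq0.
move: e e0 eE => e e0 eE.
have mAB : measurable (T @^-1` `[a, b]).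
  by apply: measurable_RV_preimage; exact: measurable_itv.
have aeT : {ae P, forall w, T w \in `[a, b]}.
  exists (~` (T @^-1` `[a, b])); split; first exact: measurableC.
    by rewrite probability_setC // Tab subee.
  by move=> w /=; exact: contra_not.
pose A k := T @^-1` `[k%:R * e, +oo[.
have mA k : measurable (A k).
  by apply: measurable_RV_preimage; exact: measurable_itv.
pose g w := e * \sum_(k < L.+1) (\1_(A k) w : R).
have mg : measurable_fun setT g.
  apply: measurable_funM => //; apply: measurable_sum => k.
  exact: measurable_indic.
have mT : measurable_fun setT T by exact: measurable_funP.
have g0 w : 0 <= g w by rewrite mulr_ge0 // sumr_ge0.
have Eg : ('E_P[g] = (e * \sum_(k < L.+1) law `[k%:R * e, +oo[)%:E)%E.
  rewrite unlock /g.
  under eq_integral do rewrite EFinM -sumEFin.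
  rewrite ge0_integralZl_EFin //.
  - rewrite ge0_integral_sum //.
      rewrite [in RHS]EFinM -sumEFin; congr (_ * _)%E; apply: eq_bigr => k _.
      by rewrite integral_indic // setIT -lawE.
    by move=> k; apply/measurable_EFinP; exact: measurable_indic.
  - by move=> w _; rewrite sume_ge0 // => k _; rewrite lee_fin.
  - apply: emeasurable_sum => k; apply/measurable_EFinP.
    exact: measurable_indic.
rewrite -lee_fin -Eg -ET.
have -> : ('E_P[T] = 'E_P[fun w => Num.max 0%R (T w)])%E.
  rewrite unlock; apply: ae_eq_integral => //.
  - by apply/measurable_EFinP.
  - by apply/measurable_EFinP; apply: measurable_maxr.
  - apply: filterS aeT => w; rewrite in_itv /= => /andP[aT _] _.
    by rewrite max_r // (le_trans a0 aT).
apply: expectation_le => //.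
- exact: measurable_maxr.
- by move=> w; rewrite le_max lexx.
apply: filterS aeT => w; rewrite in_itv /= => /andP[aT Tb].
have T0 := le_trans a0 aT; rewrite max_r // /g.
rewrite (le_trans (@level_sum_ge _ L _ _ T0 e0 _)) ?eE //.
rewrite ler_wpM2l // ler_sum // => k _; rewrite indicE ler_nat.
by case: leP => //= kT; rewrite mem_set // /A /= in_itv /= kT.
Qed.

End Law.

(** * The approximation ratio of large random instances *)

Section LargeInstances.
Variables (R : realType) (d : measure_display) (Omega : measurableType d).
Variables (P : probability Omega R) (T : {RV P >-> R}).

(** All that is used of independence and equidistribution. *)
Lemma cells_prob M N (J : random_instance T M N)
    (S : {set 'I_M.+1 * 'I_N.+1}) (B : set R) : measurable B ->
  ri_prob J [set w | forall c, c \in S -> B (ri_time J c w)]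
    = (law T B ^+ #|S|)%:E.
Proof.
move=> mB; rewrite (ri_indep J S (B := fun=> B)) //.
rewrite (eq_bigr (fun=> (law T B)%:E)) => [|c _].
  by rewrite prodEFin prodr_const.
by rewrite -lawE //; exact: ri_ident.
Qed.

Lemma measurable_cells M N (J : random_instance T M N)
    (S : {set 'I_M.+1 * 'I_N.+1}) (B : set R) : measurable B ->
  measurable [set w | forall c, c \in S -> B (ri_time J c w)].
Proof.
move=> mB; rewrite (_ : [set w | _] =
  \bigcap_(c in [set c | c \in S]) (ri_time J c @^-1` B)); last first.
  by apply/seteqP; split=> w.
apply: fin_bigcap_measurable => [|c _]; first exact: finite_finset.
exact: measurable_RV_preimage.
Qed.

Variables (mm nn : nat -> nat).
Variable J : forall n, random_instance T (mm n) (nn n).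
Notation cell n := ('I_(mm n).+1 * 'I_(nn n).+1)%type.
Notation iwhp := (whp (fun n => ri_prob (J n))).

Lemma all_cells_whp (B : set R) : measurable B -> law T B = 1 ->
  iwhp (fun n => [set w | forall c, B (ri_time (J n) c w)]).
Proof.
move=> mB PB e e0; apply: nearW => n.
exists [set w | forall c, c \in [set: cell n]%SET -> B (ri_time (J n) c w)].
have mF := measurable_cells (J n) [set: cell n]%SET mB.
split => //; first by move=> w H c; apply: H; rewrite inE.
by rewrite probability_setC // cells_prob // PB expr1n subee ?lee_fin ?ltW.
Qed.

(** Weak law of large numbers for the number of sets of cells, among [n + 1]
    disjoint ones of size [k], whose entries all fall in [B].  Disjointness makes
    the corresponding events pairwise independent, of probability
    [law T B ^+ k]. *)
Lemma count_whp (S : forall n, 'I_n.+1 -> {set cell n}) (k : nat) (B : set R)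
    (e : R) :
  measurable B -> 0 < e -> (forall n l, #|S n l| = k) ->
  (forall n l l', l != l' -> (S n l :&: S n l')%SET = finset.set0) ->
  iwhp (fun n => [set w | n.+1%:R * (law T B ^+ k - e) <=
    \sum_(l < n.+1)
      (`[< forall c, c \in S n l -> B (ri_time (J n) c w) >] : nat)%:R]).
Proof.
move=> mB e0 cS dS e' e'0.
(* From this rank on, the Chebyshev bound [e ^- 2 / (n + 1)] is at most [e']. *)
have [n0 _ n0P] := @nbhs_infty_ger R (e ^- 2 / e').
exists n0 => // n /n0P /= nP.
pose E (l : 'I_n.+1) := [set w | forall c, c \in S n l -> B (ri_time (J n) c w)].
have mE l : measurable (E l) by exact: measurable_cells.
have QE l : ri_prob (J n) (E l) = (law T B ^+ k)%:E.
  by rewrite cells_prob // cS.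
have QEE l l' : l != l' ->
    ri_prob (J n) (E l `&` E l') = ((law T B ^+ k) ^+ 2)%:E.
  move=> /dS dll'; rewrite (_ : E l `&` E l' =
    [set w | forall c, c \in (S n l :|: S n l')%SET -> B (ri_time (J n) c w)]).
    rewrite cells_prob // cardsU dll'.
    by rewrite cards0 subn0 !cS exprD expr2.
  apply/seteqP; split=> w /=; first by move=> [H H'] c /setUP[]; auto.
  by move=> H; split=> c cS'; apply: H; rewrite inE cS' ?orbT.
have dev := count_deviation e0 mE QE QEE.
have mS : measurable_fun setT (fun w => \sum_(l < n.+1) (\1_(E l) w : R)).
  by apply: measurable_sum => l; exact: measurable_indic.
exists [set w | n.+1%:R * (law T B ^+ k - e) <= \sum_(l < n.+1) (\1_(E l) w : R)].
split.
- exact: measurable_le_const.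
- move=> w /= /le_trans; apply; apply: ler_sum => l _; rewrite indicE ler_nat.
  by rewrite (asbool_equiv_eq (Q := w \in E l)) //; rewrite inE.
rewrite (_ : ~` _ =
  [set w | \sum_(l < n.+1) (\1_(E l) w : R) < n.+1%:R * (law T B ^+ k - e)]).
  apply: (le_trans dev); rewrite lee_fin ler_pdivrMr ?ltr0n // -ler_pdivrMl //.
  by rewrite mulrC (le_trans nP) // ler_nat.
by apply/seteqP; split=> w /=; rewrite ltNge => /negP.
Qed.

Variables (a b mu : R).
Hypothesis a0 : 0 <= a.
Hypothesis Tab : P (T @^-1` `[a, b]) = 1%E.
Hypothesis ET : 'E_P[T]%E = mu%:E.
Hypothesis mu0 : 0 < mu.

Let law_le_1 (i : interval R) : law T [set` i] <= 1.
Proof. by apply: law_le1; exact: measurable_itv. Qed.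

(* With the single level 0, [mean_le_levels] reads [mu <= b * P (0 <= T)]. *)
Let mu_le_b : mu <= b.
Proof.
have := mean_le_levels 0 a0 Tab ET; rewrite big_ord1 mul0r divr1.
have := law_ge0 T `[0, +oo[; have := law_le_1 `[0, +oo[.
move: (law _ _) => q q1 q0 mubq.
have /ltW b0 : 0 < b.
  rewrite ltNge; apply/negP => b0; have := mulr_le0_ge0 b0 q0.
  by rewrite leNgt (lt_le_trans mu0 mubq).
by rewrite (le_trans mubq) // ler_piMr.
Qed.

Let entries_whp :
  iwhp (fun n => [set w | forall c, a <= ri_time (J n) c w <= b]).
Proof.
have := @all_cells_whp [set` `[a, b]] (measurable_itv _).
rewrite /law Tab => /(_ erefl); apply: whp_sub; apply: nearW => n w H c.
by have := H c; rewrite /= in_itv.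
Qed.

(** Lower half of the weak law of large numbers, for one entry per line.  Half of
    the error [e] is spent on the step [dl] of the levels, and half on the
    frequencies of the level events: there are [L] of them, each weighted by [dl]
    and off by at most [e / (2 * b)], and [L * dl <= b]. *)
Lemma sum_whp (r : forall n, 'I_n.+1 -> cell n) (e : R) :
  0 < e -> (forall n, injective (r n)) ->
  iwhp (fun n => [set w |
    n.+1%:R * (mu - e) <= \sum_l ri_time (J n) (r n l) w]).
Proof.
move=> e0 rI; have b0 : 0 < b := lt_le_trans mu0 mu_le_b.
pose L := Num.bound (2 * b / e).
have Le : 2 * b <= L.+1%:R * e.
  rewrite -ler_pdivrMr // (le_trans (ltW (archi_boundP _))) ?ler_nat //.
  by rewrite divr_ge0 ?mulr_ge0 // ltW.
pose dl := b / L.+1%:R.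
have dl0 : 0 <= dl by rewrite divr_ge0 // ltW.
have dlE : L.+1%:R * dl = b by rewrite /dl mulrC divfK // pnatr_eq0.
have ed : 2 * dl <= e.
  by rewrite -(@ler_pM2l _ L.+1%:R) ?ltr0n // mulrCA dlE.
pose q k := law T `[k%:R * dl, +oo[.
have muq : mu <= dl * \sum_(k < L.+1) q k by exact: mean_le_levels a0 Tab ET.
have eb : 0 < e / (2 * b) by rewrite divr_gt0 // mulr_gt0.
have cw k : iwhp (fun n => [set w | n.+1%:R * (q k.+1 - e / (2 * b)) <=
    \sum_(l < n.+1) ((k.+1%:R * dl <= ri_time (J n) (r n l) w)%R : nat)%:R]).
  have cw := @count_whp (fun n l => [set r n l]%SET) 1
    [set` `[k.+1%:R * dl, +oo[] _ (measurable_itv _) eb (fun _ _ => cards1 _).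
  rewrite expr1 in cw.
  apply: whp_sub (cw _); last first.
    move=> n l l' ll'; apply/setP => c; rewrite !inE.
    by apply/negP => /andP[/eqP-> /eqP/rI ll2]; rewrite ll2 eqxx in ll'.
  apply: nearW => n w /= /le_trans; apply; apply: ler_sum => l _.
  rewrite ler_nat; case: asboolP => //= /(_ (r n l)).
  by rewrite inE eqxx in_itv /= andbT => ->.
apply: whp_sub (whpI entries_whp (whp_bigI L cw)).
apply: nearW => n w [/= ent cnt].
have lower : dl * \sum_(k < L) \sum_(l < n.+1)
    ((k.+1%:R * dl <= ri_time (J n) (r n l) w)%R : nat)%:R
    <= \sum_l ri_time (J n) (r n l) w.
  rewrite exchange_big mulr_sumr /=; apply: ler_sum => l _.
  apply: level_sum_le => //; by have /andP[/(le_trans a0)] := ent (r n l).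
apply: le_trans lower.
have : dl * \sum_(k < L) n.+1%:R * (q k.+1 - e / (2 * b)) <=
   dl * \sum_(k < L) \sum_(l < n.+1)
    ((k.+1%:R * dl <= ri_time (J n) (r n l) w)%R : nat)%:R.
  by rewrite ler_wpM2l // ler_sum // => k _; exact: cnt.
apply: le_trans; rewrite -mulr_sumr mulrCA ler_wpM2l //.
rewrite sumrB sumr_const card_ord mulrBr.
have q01 : q 0%N <= 1 by exact: law_le_1.
move: muq; rewrite big_ord_recl mulrDr => muq.
have dq : dl * q 0%N <= dl by rewrite ler_piMr.
have de : dl * (e / (2 * b) *+ L) <= e / 2.
  rewrite (_ : e / 2 = L.+1%:R * dl * (e / (2 * b))).
    rewrite -[X in dl * X]mulr_natl mulrA ler_wpM2r ?(ltW eb) //.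
    by rewrite mulrC ler_wpM2r // ler_nat.
  by rewrite dlE; field; rewrite gt_eqF.
have -> : \sum_(k < L) q k.+1 = \sum_(i < L) q (lift ord0 i) by [].
lra.
Qed.

(* The event [T < b] is the union of the null events [T <= b - 1 / (k + 1)]. *)
Let point_law : (forall c, c < b -> law T `]-oo, c] = 0) -> law T [set b] = 1.
Proof.
move=> T0; have m1 := measurable_RV_preimage T (measurable_set1 b).
have mc i := measurable_RV_preimage T (measurable_itv (i : interval R)).
have PC : P (~` (T @^-1` `[a, b])) = 0%E by rewrite probability_setC // Tab subee.
have neg : P.-negligible (~` (T @^-1` [set b])).
  pose F (k : nat) := T @^-1` `]-oo, b - k.+1%:R^-1].
  apply: (@negligibleS _ _ _ _ (~` (T @^-1` `[a, b]) `|` \bigcup_k F k)); last first.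
    apply: negligibleU.
      by exists (~` (T @^-1` `[a, b])); split => //; exact: measurableC.
    apply: negligible_bigcup => k.
    have PF : P (F k) = 0%E.
      rewrite lawE; last exact: measurable_itv.
      by rewrite T0 // ltrBlDr ltrDl invr_gt0.
    by exists (F k); split => //; exact: mc.
  move=> w /= Tb; have [Tw|] := pselect ((T @^-1` `[a, b]) w); last by left.
  right; move: Tw; rewrite /= in_itv /= => /andP[_ leb].
  have bT : 0 < b - T w by rewrite subr_gt0 lt_neqAle leb andbT; apply/eqP.
  exists (Num.bound (b - T w)^-1) => //; rewrite /F /= in_itv /=.
  rewrite lerBrDr -lerBrDl -[leRHS]invrK lef_pV2 ?posrE ?invr_gt0 //.
  rewrite (le_trans (ltW (archi_boundP _))) ?ler_nat //.
  by rewrite invr_ge0 ltW.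
rewrite /law -(setCK (T @^-1` [set b])) probability_setC; last exact: measurableC.
by rewrite (measure_negligible (measurableC m1) neg) sube0.
Qed.

(** Common core of the two limits.  Here [line] sends a cell to its line, column or
    row, and [r] selects one cell on each line; the two hypotheses after the size
    of the lines are the bounds on the makespan by line maxima and on the optimum
    by the selected cells. *)
Lemma ratio_whp (A : algorithm R) (K : nat)
    (line : forall n, cell n -> 'I_n.+1) (r : forall n, 'I_n.+1 -> cell n) :
  (forall n, cancel (r n) (line n)) ->
  (forall n l, #|[set c | line n c == l]%SET| = K.+1) ->
  (forall n (t : 'M[R]_((mm n).+1, (nn n).+1)) s m x,
    (forall i j, t i j <= m (line n (i, j))) -> (forall i j, t i j <= x) ->
    makespan t s <= \sum_l m l + x *+ K) ->
  (forall n (t : 'M[R]_((mm n).+1, (nn n).+1)), (forall i j, 0 <= t i j) ->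
    \sum_l t (r n l).1 (r n l).2 <= opt t) ->
  iwhp (fun n => [set w : ri_space (J n) | approx_ratio A (ri_matrix w) <= b / mu]).
Proof.
move=> rK cardL upper lower; have b0 : 0 < b := lt_le_trans mu0 mu_le_b.
have ratio_le M N (t : 'M[R]_(M.+1, N.+1)) : 0 <= opt t ->
    makespan t (A M N t) <= b / mu * opt t -> approx_ratio A t <= b / mu.
  rewrite /approx_ratio le_eqVlt => /predU1P[<- _|o0]; last by rewrite ler_pdivrMr.
  by rewrite invr0 mulr0 divr_ge0 // ltW.
have [[c [cb Tc]]|nT] := pselect (exists c, c < b /\ 0 < law T `]-oo, c]);
  last first.
  have T1 : law T [set b] = 1.
    apply: point_law => c cb; apply/eqP; rewrite eq_le law_ge0 andbT leNgt.
    by apply/negP => Tc; apply: nT; exists c.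
  apply: whp_sub (all_cells_whp (measurable_set1 b) T1).
  apply: nearW => n w /= eb; rewrite /approx_ratio (@makespan_const _ _ _ _ _ b).
    have [->|o0] := eqVneq (opt (ri_matrix w)) 0.
      by rewrite mul0r divr_ge0 // ltW.
    by rewrite divff // ler_pdivlMr // mul1r.
  by move=> i j; rewrite mxE.
pose p := law T `]-oo, c] ^+ K.+1.
have p0 : 0 < p by rewrite exprn_gt0.
(* In the limit, the lines with entries at most [c] lower the mean of the line
   maxima by at least [g] below [b].  Of this margin, [g / 2] is lost on the
   frequency of these lines, [g / 4] on the sum of the selected entries (this is
   [b / mu] times the error given to [sum_whp]), and [g / 4] pays for [b *+ K]. *)
pose g := (b - c) * p; have g0 : 0 < g by rewrite mulr_gt0 // subr_gt0.
have rI n : injective (r n) := can_inj (rK n).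
have e10 : 0 < g * mu / (4 * b) by rewrite divr_gt0 // mulr_gt0.
have sw := sum_whp e10 rI.
have p20 : 0 < p / 2 by rewrite divr_gt0.
have lineI n l l' : l != l' -> ([set c | line n c == l] :&:
    [set c | line n c == l'])%SET = finset.set0.
  move=> ll'; apply/setP => x; rewrite !inE.
  by apply/negP => /andP[/eqP ll1 /eqP ll2]; rewrite -ll1 -ll2 eqxx in ll'.
have cw := count_whp (measurable_itv `]-oo, c]) p20 cardL lineI.
have [n0 _ n0P] := @nbhs_infty_ger R (4 * (b *+ K) / g).
apply: whp_sub (whpI entries_whp (whpI sw cw)).
exists n0 => // n /n0P /= nP w [ent [sm cnt]].
pose t := ri_matrix w; pose N := n.+1%:R : R.
have NK : b *+ K <= N * (g / 4).
  have : 4 * (b *+ K) / g <= N by rewrite (le_trans nP) // ler_nat.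
  rewrite ler_pdivrMr //; lra.
have tE i j : t i j = ri_time (J n) (i, j) w by rewrite mxE.
have t0 i j : 0 <= t i j by rewrite tE; have /andP[/(le_trans a0)] := ent (i, j).
have tb i j : t i j <= b by rewrite tE; have /andP[] := ent (i, j).
have optN : N * (mu - g * mu / (4 * b)) <= opt t.
  apply: le_trans (lower n t t0); apply: (le_trans sm); apply: ler_sum => l _.
  by rewrite tE; case: (r n l).
pose low l := (`[< forall x, x \in [set x | line n x == l]%SET ->
  [set` `]-oo, c]] (ri_time (J n) x w) >] : nat)%:R : R.
have tm i j : t i j <= b - (b - c) * low (line n (i, j)).
  rewrite /low; case: asboolP => [H|_]; last by rewrite mulr0 subr0.
  have := H (i, j); rewrite inE eqxx => /(_ erefl) /=; rewrite in_itv /= tE.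
  by rewrite mulr1 opprB addrC subrK.
have := upper n t (A _ _ t) (fun l => b - (b - c) * low l) b tm tb.
rewrite sumrB sumr_const card_ord -mulr_sumr -mulr_natl -/N => mk.
apply: ratio_le; first by apply: le_trans (lower n t t0); apply: sumr_ge0.
have lowN : (b - c) * (N * (p / 2)) <= (b - c) * \sum_l low l.
  rewrite ler_wpM2l ?subr_ge0 ?(ltW cb) //; apply: le_trans cnt.
  by rewrite ler_wpM2l // -/p; lra.
have : b / mu * (N * (mu - g * mu / (4 * b))) <= b / mu * opt t.
  by rewrite ler_wpM2l // divr_ge0 // ltW.
apply: le_trans; apply: (le_trans mk).
rewrite (_ : b / mu * _ = N * (b - g / 4)); last by field; rewrite !gt_eqF.
rewrite (_ : (b - c) * (N * (p / 2)) = N * (g / 2)) in lowN; last first.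
  by rewrite /g; field.
lra.
Qed.

End LargeInstances.

Theorem corollary11 (R : realType) (d : measure_display)
    (Omega : measurableType d) (P : probability Omega R) (T : {RV P >-> R})
    (a b mu : R) (N0 M0 : nat)
    (I : forall M N : nat, random_instance T M N)
    (A : algorithm R) :
  0 <= a ->
  P (T @^-1` `[a, b]) = 1%E ->
  ('E_P[T])%E = mu%:E ->
  0 < mu ->
  (prob_ratio_le A (I M0 N) (b / mu) @[N --> \oo] --> 1%E) /\
  (prob_ratio_le A (I M N0) (b / mu) @[M --> \oo] --> 1%E).
Proof.
move=> a0 Tab ET mu0; split; apply: whp_cvg.
- apply: (@ratio_whp _ _ _ _ _ (fun=> M0) id (fun N => I M0 N) a b mu a0 Tab ET mu0
    A M0 (fun N c => c.2) (fun N j => (ord0, j))).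
  + by [].
  + move=> N j; rewrite (_ : [set c | _]%SET =
        finset.setX [set: 'I_M0.+1]%SET [set j]%SET).
      by rewrite cardsX cardsT card_ord cards1 muln1.
    by apply/setP => c; rewrite !inE.
  + by move=> N t s m x tm; exact: (@makespan_le_cols _ _ _ t s m x tm).
  + by move=> N t t0; exact: (opt_ge_row ord0 t0).
- apply: (@ratio_whp _ _ _ _ _ id (fun=> N0) (fun M => I M N0) a b mu a0 Tab ET mu0
    A N0 (fun M c => c.1) (fun M i => (i, ord0))).
  + by [].
  + move=> M i; rewrite (_ : [set c | _]%SET =
        finset.setX [set i]%SET [set: 'I_N0.+1]%SET).
      by rewrite cardsX cardsT card_ord cards1 mul1n.
    by apply/setP => c; rewrite !inE andbT.
  + by move=> M t s m x tm; exact: (@makespan_le_rows _ _ _ t s m x tm).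
  + by move=> M t t0; exact: (opt_ge_col ord0 t0).
Qed.
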